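(* If $G$ and $H$ are connected graphs, then $$\chi_{\mu_i}(G\boxtimes H)\ge \max\left\{\left\lceil\frac{\operatorname{diag}(G\boxtimes H)}{2}\right\rceil,\ \omega(G)\,\omega(H)\right\}.$$
   Context: All graphs are finite and simple. The strong product $G\boxtimes H$ has vertex set $V(G)\times V(H)$, with distinct $(g,h),(g',h')$ adjacent iff ($g=g'$ or $gg'\in E(G)$) and ($h=h'$ or $hh'\in E(H)$). $\omega$ is the clique number. A subgraph of a graph is convex if every geodesic (shortest path) between two of its vertices lies entirely in it; a convex path is a path subgraph that is convex. If $g_1\dots g_k$ and $h_1\dots h_k$ are convex paths in $G$ and $H$, the subgraph of $G\boxtimes H$ induced by $\{(g_1,h_1),\dots,(g_k,h_k)\}$ is a diagonal; $\operatorname{diag}(G\boxtimes H)$ is the maximum number of vertices of a diagonal in $G\boxtimes H$. For $X\subseteq V$, two vertices $x,y\in X$ are $X$-visible if some $x,y$-geodesic has no internal vertex in $X$; $X$ is an independent mutual-visibility (IMV) set if $X$ is independent and every two of its vertices are $X$-visible. $\chi_{\mu_i}$ is the least $k$ such that the vertex set can be partitioned into $k$ IMV sets. *)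

(* Defs.v *)
From mathcomp Require Import all_boot.

Set Implicit Arguments.
Unset Strict Implicit.
Unset Printing Implicit Defensive.

Record sgraph := SGraph {
  vertex :> finType;
  adj : rel vertex;
  adj_sym : symmetric adj;
  adj_irrefl : irreflexive adj
}.

Section Graph.
Variable G : sgraph.
Implicit Types (x y : G) (p s : seq G) (X S : {set G}) (F : rel G).

Definition connected := [forall x, forall y, connect (@adj G) x y].

Definition independent X := [forall x in X, forall y in X, ~~ adj x y].

Definition clique X := [forall x in X, forall y in X, (x != y) ==> adj x y].

Definition clique_number := \max_(X | clique X) #|X|.

(* The vertices of the path are x :: p, so that size p is its length. *)
Definition is_path x y p := [&& path (@adj G) x p, last x p == y & uniq (x :: p)].

(* Vertices on a path are distinct, hence bounding the length of the sequences
   by #|G|, here and below, excludes no path. *)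
Definition geodesic x y p :=
  is_path x y p &&
  [forall q : {bseq #|G| of G}, is_path x y q ==> (size p <= size q)].

Definition internal x p := behead (belast x p).

Definition visible X x y :=
  [exists p : {bseq #|G| of G},
     geodesic x y p && all (fun z => z \notin X) (internal x p)].

Definition imv_set X :=
  independent X && [forall x in X, forall y in X, (x != y) ==> visible X x y].

Definition imv_partition (P : {set {set G}}) :=
  partition P [set: G] && [forall X in P, imv_set X].

Definition imv_colorable k := [exists P, imv_partition P && (#|P| == k)].

Lemma imv_colorable_ex : exists k, imv_colorable k.
Proof.
pose P := preim_partition id [set: G].
have inj X x y : X \in P -> x \in X -> y \in X -> x = y.
  by case/imsetP=> z _ ->; rewrite !inE /= => /eqP <- /eqP <-.
exists #|P|; apply/existsP; exists P; rewrite eqxx andbT.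
rewrite /imv_partition preim_partitionP /=.
apply/forall_inP=> X PX; apply/andP; split.
  apply/forall_inP=> x Xx; apply/forall_inP=> y Xy.
  by rewrite (inj X x y) // adj_irrefl.
apply/forall_inP=> x Xx; apply/forall_inP=> y Xy.
by rewrite (inj X x y) // eqxx.
Qed.

Definition chi_mui := ex_minn imv_colorable_ex.

(* A subgraph is given by its vertex set S and its edge relation F.  It need
   not be induced: a geodesic must have its edges in F, not only its vertices
   in S. *)
Definition convex S F :=
  [forall x in S, forall y in S, forall p : {bseq #|G| of G},
     geodesic x y p ==> (all (fun z => z \in S) (x :: p) && path F x p)].

Definition path_edge s : rel G :=
  fun x y => ((x, y) \in zip s (behead s)) || ((y, x) \in zip s (behead s)).

Definition convex_path s :=
  [&& 0 < size s, sorted (@adj G) s, uniq s & convex [set z in s] (path_edge s)].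

End Graph.

Section StrongProduct.
Variables G H : sgraph.

Definition strong_adj : rel (G * H) := fun u v =>
  [&& u != v, (u.1 == v.1) || adj u.1 v.1 & (u.2 == v.2) || adj u.2 v.2].

Fact strong_adj_sym : symmetric strong_adj.
Proof.
move=> u v; rewrite /strong_adj eq_sym [u.1 == _]eq_sym [u.2 == _]eq_sym.
by rewrite [adj u.1 _]adj_sym [adj u.2 _]adj_sym.
Qed.

Fact strong_adj_irrefl : irreflexive strong_adj.
Proof. by move=> u; rewrite /strong_adj eqxx. Qed.

Definition strong_product := SGraph strong_adj_sym strong_adj_irrefl.

(* A diagonal is an induced subgraph, so it is identified with its vertex
   set. *)
Definition diagonal (D : {set strong_product}) :=
  [exists s : {bseq #|G| of G}, exists t : {bseq #|H| of H},
     [&& convex_path s, convex_path t, size s == size t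
       & D == [set u in zip s t]]].

Definition diag := \max_(D | diagonal D) #|D|.

End StrongProduct.

(* Main.v *)
Require Import Defs.
From mathcomp Require Import all_boot.

Set Implicit Arguments.
Unset Strict Implicit.
Unset Printing Implicit Defensive.

(** Each colour class meets a diagonal in at most two vertices: the diagonal
    between two of its vertices is their only geodesic in the strong product,
    because its projections are the only geodesics between their ends in the
    factors, and so a third vertex of the class between them would block
    visibility.  A colour class also meets a product of two cliques, which is
    itself a clique, in at most one vertex. *)

(** Projecting a path of the strong product to a factor gives a walk that may pause at a vertex. A
    pause repeats a vertex, so a walk without repetitions is an honest path. *)
Lemma path_uniq_reflexive_closure (T : eqType) (e : rel T) x p :
  path (fun y z => (y == z) || e y z) x p -> uniq (x :: p) -> path e x p.
Proof.
elim: p x => //= y p IHp x /andP[exy ep] /andP[xnp up].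
rewrite IHp // andbT; case/orP: exy => // /eqP xy.
by rewrite xy mem_head in xnp.
Qed.

Lemma card_leq_partition (T : finType) (P : {set {set T}}) (D : {set T}) k :
  partition P [set: T] -> (forall X, X \in P -> #|X :&: D| <= k) ->
  #|D| <= #|P| * k.
Proof.
move=> /and3P[/eqP coverP _ _] leXk; rewrite -sum_nat_const.
have -> : D = \bigcup_(X in P) (X :&: D).
  apply/setP=> x; have: x \in cover P by rewrite coverP.
  case/bigcupP=> X PX Xx; apply/idP/bigcupP => [Dx | [Y _]].
    by exists X; rewrite // inE Xx.
  by case/setIP.
apply: leq_trans (leq_sum _ _); last exact: leXk.
elim/big_rec2: _ => [|X n A _ leA]; first by rewrite cards0.
by rewrite (leq_trans (leq_card_setU _ _)) // leq_add.
Qed.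

(** * Geodesics, and positions along a path *)

Section Graph.
Variable G : sgraph.
Implicit Types (x y : G) (p q s : seq G).

Lemma is_path_size x y p : is_path x y p -> size p <= #|G|.
Proof. by case/and3P=> _ _ /= /andP[_ /card_uniqP <-]; apply: max_card. Qed.

Lemma mem_internal x y p r :
  0 < r < size p -> nth y (x :: p) r \in internal x p.
Proof.
case: p r => [|z p] [|r] //=; rewrite ltnS => ltr.
by rewrite /internal /= lastI nth_rcons size_belast ltr mem_nth ?size_belast.
Qed.

(** By [is_path_size] every path fits the length bound built into [geodesic], so minimality extends
    to all sequences. *)
Lemma geodesicP x y p :
  reflect (is_path x y p /\ forall q, is_path x y q -> size p <= size q)
          (geodesic x y p).
Proof.
apply: (iffP andP) => [[pathp /forallP minp] | [pathp minp]]; split=> //.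
  move=> q pathq.
  by have /implyP := minp (Bseq (is_path_size pathq)); apply.
by apply/forallP=> q; apply/implyP=> /minp.
Qed.

Lemma geodesic_exists x y p :
  is_path x y p -> exists2 q, geodesic x y q & size q <= size p.
Proof.
move=> pathp; pose P (q : {bseq #|G| of G}) := is_path x y q.
have Pp : P (Bseq (is_path_size pathp)) by [].
case: (arg_minnP (fun q : {bseq #|G| of G} => size q) Pp) => q pathq minq.
exists q; last exact: minq Pp.
apply/geodesicP; split=> // r pathr.
exact: (minq (Bseq (is_path_size pathr)) pathr).
Qed.

Lemma path_edge_index s x y :
  uniq s -> path_edge s x y -> index y s <= (index x s).+1.
Proof.
have nth_edge u v : (u, v) \in zip s (behead s) ->
    exists2 i, i.+1 < size s & u = nth u s i /\ v = nth u s i.+1.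
  case: s => // a s' /(nthP (u, u))[i].
  rewrite size_zip /= => ltis; rewrite nth_zip_cond size_zip ltis => -[eu ev].
  have lti : i < size s' by rewrite (leq_trans ltis) ?geq_minr.
  by exists i => //=; split; rewrite ?eu ?ev.
move=> us /orP[] /nth_edge[i lti [eu ev]].
  rewrite {1}ev {2}eu !index_uniq // ltnW //.
by rewrite {1}eu ev !index_uniq // ltnW // leqW.
Qed.

Lemma path_edge_index_last s x p : uniq s -> path (path_edge s) x p ->
  index (last x p) s <= index x s + size p.
Proof.
move=> us; elim: p x => [|y p IHp] x /=; first by rewrite addn0.
case/andP=> exy /IHp /leq_trans; apply.
by rewrite addnS -addSn leq_add2r path_edge_index.
Qed.

(** Each edge raises the index in [s] by at most one. If the total rise reaches the number of edges,
    no edge can fall short, so the index grows by exactly one each time. The bound on the first [r]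
    edges gives one inequality, the bound on the remaining ones the other. *)
Lemma path_edge_index_nth s x p r : uniq s -> path (path_edge s) x p ->
    index x s + size p <= index (last x p) s -> r <= size p ->
  index (nth x (x :: p) r) s = index x s + r.
Proof.
move=> us pathp lep ler; apply/eqP; rewrite eqn_leq; apply/andP; split.
  have := path_edge_index_last us (take_path r pathp).
  by rewrite size_takel // (last_nth x) size_takel // -[_ :: _]/(take r.+1 (x :: p)) nth_take.
have pathd : path (path_edge s) (last x (take r p)) (drop r p).
  by move: pathp; rewrite -{1}(cat_take_drop r p) cat_path => /andP[].
have := path_edge_index_last us pathd.
rewrite -last_cat cat_take_drop size_drop => /(leq_trans lep).
rewrite (last_nth x) size_takel // -[_ :: _]/(take r.+1 (x :: p)) nth_take // => le.
by rewrite -(leq_add2r (size p - r)) -addnA subnKC.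
Qed.

(** * Rigidity of short walks between vertices of a convex path *)

Section ConvexPath.
Variables (s : seq G) (x0 : G) (i l : nat).
Hypotheses (cs : convex_path s) (leil : i <= l) (ltls : l < size s).
Let us : uniq s. Proof. by case/and4P: cs. Qed.
Let ltis : i < size s. Proof. exact: leq_ltn_trans ltls. Qed.

Lemma convex_path_geodesic p :
  geodesic (nth x0 s i) (nth x0 s l) p -> path (path_edge s) (nth x0 s i) p.
Proof.
move=> geop; have /geodesicP[/is_path_size szp _] := geop.
have /and4P[_ _ _ /forall_inP convs] := cs.
have /convs/forall_inP conv_i : nth x0 s i \in [set z in s].
  by rewrite inE mem_nth.
have /conv_i/forallP conv_il : nth x0 s l \in [set z in s].
  by rewrite inE mem_nth.
by have /implyP/(_ geop)/andP[] := conv_il (Bseq szp).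
Qed.

(** A geodesic is no longer than [p], and convexity makes it run along the edges of [s], where each
    edge advances the index by at most one. *)
Lemma convex_path_dist p :
  is_path (nth x0 s i) (nth x0 s l) p -> l - i <= size p.
Proof.
case/geodesic_exists=> q geoq; apply: leq_trans.
have /geodesicP[/and3P[_ /eqP lastq _] _] := geoq.
have := path_edge_index_last us (convex_path_geodesic geoq).
by rewrite lastq !index_uniq // leq_subLR.
Qed.

(** A walk with pauses that is no longer than the distance has no slack for a pause or a detour: it
    is a geodesic, and convexity then forces it to follow [s] vertex by vertex. *)
Lemma convex_path_short_walk p r :
    path (fun x y => (x == y) || adj x y) (nth x0 s i) p ->
    last (nth x0 s i) p = nth x0 s l -> size p <= l - i -> r <= l - i ->
  size p = l - i /\ nth x0 (nth x0 s i :: p) r = nth x0 s (i + r).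
Proof.
move=> walkp lastp lep ler.
(* Removing repetitions leaves a path [q] with at least [l - i] edges, hence no shorter than [p]; so
   [p] had none to remove. *)
have up : uniq (nth x0 s i :: p).
  case: (shortenP walkp) lastp => q walkq uq subq lastq.
  have pathq : is_path (nth x0 s i) (nth x0 s l) q.
    by rewrite /is_path path_uniq_reflexive_closure // lastq eqxx.
  apply: leq_size_uniq uq _ _; last first.
    by rewrite ltnS (leq_trans lep) // convex_path_dist.
  by move=> z; rewrite !inE => /orP[-> // | /subq ->]; rewrite orbT.
have pathp : is_path (nth x0 s i) (nth x0 s l) p.
  by rewrite /is_path path_uniq_reflexive_closure // lastp eqxx.
have szp : size p = l - i.
  by apply/eqP; rewrite eqn_leq lep convex_path_dist.
have geop : geodesic (nth x0 s i) (nth x0 s l) p.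
  by apply/geodesicP; split=> // q; rewrite szp; apply: convex_path_dist.
split=> //; rewrite -szp in ler.
have := path_edge_index_nth us (convex_path_geodesic geop) _ ler.
rewrite lastp !index_uniq // szp subnKC // => /(_ (leqnn _)).
(* [path_edge_index_nth] uses the first vertex as default; position [r] is in range, so [x0] serves
   as well. *)
rewrite (set_nth_default x0) ?ltnS // => idx.
rewrite -idx nth_index // -index_mem idx (leq_ltn_trans _ ltls) //.
by rewrite -(subnKC leil) leq_add2l -szp.
Qed.

End ConvexPath.

Lemma imv_card_clique (X K : {set G}) :
  imv_set X -> clique K -> #|X :&: K| <= 1.
Proof.
case/andP=> indX _ clK; rewrite leqNgt; apply/card_gt1P=> -[x [y []]].
rewrite !inE => /andP[Xx Kx] /andP[Xy Ky] neq.
have := forall_inP (forall_inP clK x Kx) y Ky; rewrite neq /= => exy.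
by have := forall_inP (forall_inP indX x Xx) y Xy; rewrite exy.
Qed.

Lemma chi_mui_partition :
  exists2 P : {set {set G}}, imv_partition P & #|P| = chi_mui G.
Proof.
rewrite /chi_mui; case: ex_minnP => k /existsP[P /andP[imvP /eqP cardP]] _.
by exists P.
Qed.

Lemma clique_number_witness :
  exists2 K : {set G}, clique K & #|K| = clique_number G.
Proof.
have cl0 : clique (set0 : {set G}) by apply/forall_inP=> x; rewrite inE.
by rewrite /clique_number (bigmax_eq_arg set0) //; case: arg_maxnP => // K;
  exists K.
Qed.

End Graph.

Section StrongProduct.
Variables G H : sgraph.
Local Notation GH := (strong_product G H).

Lemma clique_setX (K : {set G}) (L : {set H}) :
  clique K -> clique L -> clique (setX K L : {set GH}).
Proof.
move=> clK clL; apply/forall_inP=> -[x x'] /setXP[Kx Lx'].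
apply/forall_inP=> -[y y'] /setXP[Ky Ly']; apply/implyP=> neq.
rewrite /adj /= /strong_adj neq /=.
have := forall_inP (forall_inP clK x Kx) y Ky.
have := forall_inP (forall_inP clL x' Lx') y' Ly'.
by rewrite !implyNb => -> ->.
Qed.

(** * Geodesics along a diagonal, and visibility *)

Section Diagonal.
Variables (s : seq G) (t : seq H) (x0 : G) (y0 : H).
Hypotheses (cs : convex_path s) (ct : convex_path t) (eq_st : size s = size t).
Local Notation z := (nth (x0, y0) (zip s t) : nat -> GH).

(** The witness is the segment of [zip s t] from [i] to [l]: successive entries are adjacent in both
    coordinates. It bounds the distance in the product from above. *)
Lemma diagonal_is_path i l : i <= l -> l < size s ->
  exists2 p, is_path (z i) (z l) p & size p = l - i.
Proof.
move=> leil ltls; have szz : size (zip s t) = size s.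
  by rewrite size_zip -eq_st minnn.
have ltis := leq_ltn_trans leil ltls.
have /and4P[_ ss us _] := cs; have /and4P[_ st _ _] := ct.
have sz : sorted (@adj GH) (zip s t).
  apply/(sortedP (x0, y0)) => k ltk.
  have ltks : k.+1 < size s by rewrite -szz.
  rewrite !nth_zip // /adj /= /strong_adj /= xpair_eqE.
  rewrite (elimT (sortedP x0) ss _ ltks) (elimT (sortedP y0) st) -?eq_st //.
  rewrite !orbT !andbT.
  by rewrite nth_uniq // ?ltn_eqF // ltnW.
have dropz : drop i (zip s t) = z i :: drop i.+1 (zip s t).
  by rewrite (drop_nth (x0, y0)) // szz.
have uz : uniq (z i :: drop i.+1 (zip s t)).
  by rewrite -dropz drop_uniq // zip_uniql.
have pz : path (@adj GH) (z i) (drop i.+1 (zip s t)).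
  by move: (drop_sorted i sz); rewrite dropz.
have szp : size (take (l - i) (drop i.+1 (zip s t))) = l - i.
  by rewrite size_takel // size_drop szz -subSS leq_sub2r.
exists (take (l - i) (drop i.+1 (zip s t))) => //.
rewrite /is_path take_path //= (last_nth (z i)) szp.
rewrite -[_ :: take _ _]/(take (l - i).+1 (z i :: drop i.+1 (zip s t))).
rewrite nth_take // -dropz nth_drop subnKC //.
rewrite (set_nth_default (x0, y0)) ?szz // eqxx /=.
exact: (take_uniq (l - i).+1 uz).
Qed.

(** Both projections of [p] are walks with pauses of length at most [l - i], so
    [convex_path_short_walk] fixes each coordinate of every vertex. *)
Lemma diagonal_geodesic_nth i l p r : i <= l -> l < size s -> r <= l - i ->
  geodesic (z i) (z l) p -> size p = l - i /\ nth (z i) (z i :: p) r = z (i + r).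
Proof.
move=> leil ltls ler /geodesicP[/and3P[pathp /eqP lastp _] minp].
have [q /minp lepq szq] := diagonal_is_path leil ltls.
rewrite szq in lepq.
have zE k : z k = (nth x0 s k, nth y0 t k) by rewrite nth_zip.
have walk1 : path (fun x y => (x == y) || adj x y) (nth x0 s i) (map fst p).
  have -> : nth x0 s i = (z i).1 by rewrite zE.
  by apply: homo_path pathp => u v /and3P[].
have walk2 : path (fun x y => (x == y) || adj x y) (nth y0 t i) (map snd p).
  have -> : nth y0 t i = (z i).2 by rewrite zE.
  by apply: homo_path pathp => u v /and3P[].
have [||szp nth1] := convex_path_short_walk cs leil ltls walk1 _ _ ler.
- have -> : nth x0 s i = (z i).1 by rewrite zE.
  by rewrite last_map lastp zE.
- by rewrite size_map.
have ltlt : l < size t by rewrite -eq_st.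
have [||_ nth2] := convex_path_short_walk ct leil ltlt walk2 _ _ ler.
- have -> : nth y0 t i = (z i).2 by rewrite zE.
  by rewrite last_map lastp zE.
- by rewrite size_map.
rewrite size_map in szp; split=> //.
have lt_r : r < size (z i :: p) by rewrite /= szp ltnS.
rewrite (zE (i + r)) -nth1 -nth2 (set_nth_default (x0, y0 : H)) //.
have -> : nth x0 s i :: map fst p = map fst (z i :: p) by rewrite /= zE.
have -> : nth y0 t i :: map snd p = map snd (z i :: p) by rewrite /= zE.
rewrite (nth_map (x0, y0)) // (nth_map (x0, y0)) //.
by case: (nth _ _ _).
Qed.

Lemma imv_diagonal_blocked (X : {set GH}) i j l : imv_set X ->
  i < j -> j < l -> l < size s -> z i \in X -> z j \in X -> z l \in X -> False.
Proof.
move=> /andP[_ visX] ltij ltjl ltls Xi Xj Xl.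
have leil : i <= l by rewrite ltnW // (ltn_trans ltij).
have ltil := ltn_trans ltij ltjl.
have neq_il : z i != z l.
  rewrite nth_uniq ?zip_uniql ?size_zip -?eq_st ?minnn ?ltn_eqF //.
    exact: ltn_trans ltls.
  by case/and4P: cs.
have /implyP/(_ neq_il) := forall_inP (forall_inP visX _ Xi) _ Xl.
case/existsP=> p /andP[geop /allP intX].
have ler : j - i <= l - i by rewrite leq_sub2r // ltnW.
have [szp] := diagonal_geodesic_nth leil ltls ler geop.
rewrite subnKC ?(ltnW ltij) // => nthj.
(* The vertex [z j] sits at position [j - i] of the geodesic, strictly between its ends, so
   visibility keeps it out of [X]. *)
have /negP[] // : z j \notin X.
apply: intX; rewrite -nthj mem_internal // subn_gt0 ltij szp.
by rewrite ltn_sub2r.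
Qed.

Lemma imv_card_diagonal (X : {set GH}) :
  imv_set X -> #|X :&: [set u in zip s t]| <= 2.
Proof.
move=> imvX; rewrite leqNgt; apply/card_gt2P=> -[u [v [w [[]]]]].
have szz : size (zip s t) = size s by rewrite size_zip -eq_st minnn.
rewrite !inE => /andP[Xu] /(nthP (x0, y0))[i lti iE].
move=> /andP[Xv] /(nthP (x0, y0))[j ltj jE].
move=> /andP[Xw] /(nthP (x0, y0))[l ltl lE] [].
rewrite -{}iE -{}jE -{}lE szz in lti ltj ltl Xu Xv Xw *.
have blocked := imv_diagonal_blocked imvX.
have neqP a b : z a != z b -> a != b by apply: contraNneq => ->.
move=> /neqP neij /neqP nejl /neqP neli.
(* Of the eight sign patterns, two are cyclic and contradictory; each of the other six orders the
   indices, and the middle vertex blocks the outer two. *)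
case: (ltngtP i j) neij => // ij _; case: (ltngtP j l) nejl => // jl _;
  case: (ltngtP l i) neli => // li _.
- by have := ltn_trans (ltn_trans ij jl) li; rewrite ltnn.
- exact: blocked ij jl ltl Xu Xv Xw.
- exact: blocked li ij ltj Xw Xu Xv.
- exact: blocked li jl ltj Xu Xw Xv.
- exact: blocked jl li lti Xv Xw Xu.
- exact: blocked ij li ltl Xv Xu Xw.
- exact: blocked jl ij lti Xw Xv Xu.
by have := ltn_trans (ltn_trans li jl) ij; rewrite ltnn.
Qed.

End Diagonal.

Lemma diag_leq_imv_partition (P : {set {set GH}}) :
  imv_partition P -> diag G H <= #|P| * 2.
Proof.
case/andP=> partP /forall_inP imvP.
apply/bigmax_leqP=> D /existsP[s /existsP[t /and4P[cs ct /eqP eq_st /eqP->]]].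
apply: card_leq_partition partP _ => X PX.
(* Convex paths are nonempty, so their heads can serve as the defaults [x0] and [y0]. *)
have /and4P[+ _ _ _] := cs; have /and4P[+ _ _ _] := ct.
case: (s : seq G) (t : seq H) cs ct eq_st => [|x0 s'] [|y0 t'] // cs ct eq_st _ _.
exact: imv_card_diagonal x0 y0 cs ct eq_st _ (imvP X PX).
Qed.

End StrongProduct.

Theorem theorem5p5 (G H : sgraph) (cG : connected G) (cH : connected H) :
  maxn (uphalf (diag G H)) (clique_number G * clique_number H)
    <= chi_mui (strong_product G H).
Proof.
have [P imvP <-] := chi_mui_partition (strong_product G H).
(* Half of [diag G H], rounded up, is at most [#|P|] exactly when [diag G H] is at most twice
   [#|P|]. *)
rewrite geq_max leq_uphalf_double -muln2 diag_leq_imv_partition //=.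
have [K clK <-] := clique_number_witness G.
have [L clL <-] := clique_number_witness H.
have /andP[partP /forall_inP imvX] := imvP.
rewrite -cardsX -[#|P|]muln1; apply: card_leq_partition partP _ => X PX.
exact: imv_card_clique (imvX X PX) (clique_setX clK clL).
Qed.
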